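(* Assume that the linear program $\mathcal{P}_{\mathrm{LP}}$ has a unique optimal solution $x^\star_{\mathrm{LP}}$ and that the dual problem $\mathcal{D}$ has a unique optimal solution $\lambda^\star$. Then for every selection $x(\lambda^\star) \in \mathcal{X}(\lambda^\star)$, the vectors $x^\star_{\mathrm{LP}}$ and $x(\lambda^\star)$ differ in at most $m$ subproblem components; that is, for every $x(\lambda^\star) \in \mathcal{X}(\lambda^\star)$ there exists $I_1 \subseteq I$ with $|I_1| \ge |I| - m$ such that $x_i(\lambda^\star) = (x^\star_{\mathrm{LP}})_i$ for all $i \in I_1$.
   Context: Let $I$ be a finite index set and $m$ a positive integer with $|I| > m$. For each $i \in I$ let $r_i, z_i$ be nonnegative integers, $n_i = r_i + z_i$, $c_i \in \mathbb{R}^{n_i}$, $H_i \in \mathbb{R}^{m \times n_i}$, and let $X_i = \{x \in \mathbb{R}^{r_i} \times \mathbb{Z}^{z_i} : A_i x \preceq d_i\}$ (with $A_i \in \mathbb{R}^{m_i \times n_i}$, $d_i \in \mathbb{R}^{m_i}$) be non-empty and compact. Let $b \in \mathbb{R}^m$. Inequalities $\preceq, \succeq$ between vectors are componentwise. The mixed-integer program $\mathcal{P}$ is: minimize $\sum_{i\in I} c_i^\top x_i$ subject to $\sum_{i \in I} H_i x_i \preceq b$ and $x_i \in X_i$ for all $i \in I$; it is assumed to be feasible. The program $\mathcal{P}_{\mathrm{LP}}$ is: minimize $\sum_{i\in I} c_i^\top x_i$ subject to $\sum_{i \in I} H_i x_i \preceq b$ and $x_i \in \mathrm{conv}(X_i)$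 for all $i \in I$. The dual problem $\mathcal{D}$ is: maximize over $\lambda \in \mathbb{R}^m$, $\lambda \succeq 0$, the function $-\lambda^\top b + \sum_{i \in I} \min_{x_i \in X_i} (c_i^\top x_i + \lambda^\top H_i x_i)$. Let $\mathrm{vert}(X_i)$ denote the set of vertices of $\mathrm{conv}(X_i)$. For $\lambda \succeq 0$ put $\mathcal{X}_i(\lambda) = \mathrm{vert}(X_i) \cap \arg\min_{x_i \in X_i} (c_i^\top x_i + \lambda^\top H_i x_i)$ and $\mathcal{X}(\lambda) = \prod_{i\in I} \mathcal{X}_i(\lambda)$; a selection $x(\lambda) = (x_i(\lambda))_{i \in I}$ is any element of $\mathcal{X}(\lambda)$. $(x)_i$ denotes the part of $x$ belonging to subproblem $i$. *)

(* Defs.v *)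
From HB Require Import structures.
From mathcomp Require Import all_boot all_order all_algebra.
From mathcomp Require Import all_classical all_reals all_analysis.

Set Implicit Arguments.
Unset Strict Implicit.
Unset Printing Implicit Defensive.

Import Order.TTheory GRing.Theory Num.Theory.
Import numFieldNormedType.Exports.

Local Open Scope classical_set_scope.
Local Open Scope ring_scope.

Definition vle (R : realType) (n : nat) (u v : 'cV[R]_n) : Prop :=
  forall k, u k 0 <= v k 0.

Definition dotv (R : realType) (n : nat) (u v : 'cV[R]_n) : R :=
  (u^T *m v) 0 0.

Definition argmin (R : realType) (T : Type) (S : set T) (f : T -> R) : set T :=
  [set x | S x /\ forall y, S y -> f x <= f y].

Definition argmax (R : realType) (T : Type) (S : set T) (f : T -> R) : set T :=
  [set x | S x /\ forall y, S y -> f y <= f x].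

(* A genuine minimum whenever [argmin S f] is inhabited (see [minvalE]), in
   particular when S is compact and nonempty and f is continuous
   ([compact_EVT_min]). *)
Definition minval (R : realType) (T : Type) (S : set T) (f : T -> R) : R :=
  inf [set f x | x in S].

Lemma minvalE (R : realType) (T : Type) (S : set T) (f : T -> R) (x : T) :
  argmin S f x -> minval S f = f x.
Proof.
move=> [Sx minx]; have lbx : lbound [set f y | y in S] (f x).
  by move=> _ [y Sy <-]; exact: minx.
apply/eqP; rewrite eq_le; apply/andP; split.
  by apply: ge_inf; [exists (f x) | exists x].
by apply: lb_le_inf => //; exists (f x), x.
Qed.

Definition convhull (R : realType) (n : nat) (S : set 'cV[R]_n) :
    set 'cV[R]_n :=
  smallest (fun C : set 'cV[R]_n => convex_set C) S.

Definition extreme_points (R : realType) (n : nat) (C : set 'cV[R]_n) :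
    set 'cV[R]_n :=
  [set v | C v /\ forall (x y : 'cV[R]_n) (t : R), C x -> C y ->
             0 < t < 1 -> v = t *: x + (1 - t) *: y -> x = y].

(* Data of a mixed-integer program with subproblems indexed by I and m coupling
   constraints; the vector x_i has [rdim i] real coordinates followed by
   [zdim i] integer ones. *)
Record mip (R : realType) (I : finType) (m : nat) := Mip {
  rdim : I -> nat;
  zdim : I -> nat;
  ncon : I -> nat;
  objv : forall i, 'cV[R]_(rdim i + zdim i);               (* c_i *)
  coupl : forall i, 'M[R]_(m, rdim i + zdim i);            (* H_i *)
  locmx : forall i, 'M[R]_(ncon i, rdim i + zdim i);       (* A_i *)
  locrhs : forall i, 'cV[R]_(ncon i);                      (* d_i *)
  rhs : 'cV[R]_m                                           (* b *)
}.

Section Programs.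
Variables (R : realType) (I : finType) (m : nat) (P : mip R I m).

Local Notation subvec i := 'cV[R]_(rdim P i + zdim P i).

Definition jointvec : Type := forall i, subvec i.

Definition subX (i : I) : set (subvec i) :=
  [set x : subvec i |
    (forall k : 'I_(zdim P i), x (rshift (rdim P i) k) 0 \is a Num.int) /\
    vle (locmx P i *m x) (locrhs P i)].
Arguments subX : clear implicits.

Definition vert (i : I) : set (subvec i) :=
  extreme_points (convhull (subX i)).
Arguments vert : clear implicits.

Definition objective (x : jointvec) : R :=
  \sum_i dotv (objv P i) (x i).

Definition coupling (x : jointvec) : Prop :=
  vle (\sum_i coupl P i *m x i) (rhs P).

Definition mip_feasible : set jointvec :=
  [set x | coupling x /\ forall i, subX i (x i)].

Definition lp_feasible : set jointvec :=
  [set x | coupling x /\ forall i, convhull (subX i) (x i)].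

Definition lp_optima : set jointvec :=
  argmin lp_feasible objective.

Definition lagrangian (lambda : 'cV[R]_m) (i : I) (x : subvec i) : R :=
  dotv (objv P i) x + dotv lambda (coupl P i *m x).
Arguments lagrangian : clear implicits.

Definition dual_fun (lambda : 'cV[R]_m) : R :=
  - dotv lambda (rhs P) + \sum_i minval (subX i) (lagrangian lambda i).

Definition dual_optima : set 'cV[R]_m :=
  argmax [set lambda | vle 0 lambda] dual_fun.

Definition selX (lambda : 'cV[R]_m) (i : I) : set (subvec i) :=
  vert i `&` argmin (subX i) (lagrangian lambda i).
Arguments selX : clear implicits.

Definition selections (lambda : 'cV[R]_m) : set jointvec :=
  [set x | forall i, selX lambda i (x i)].

End Programs.

Arguments jointvec {R I m} P.
Arguments subX {R I m} P i _.
Arguments vert {R I m} P i _.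
Arguments lagrangian {R I m} P lambda i x.
Arguments selX {R I m} P lambda i _.
Arguments lp_feasible {R I m} P _.
Arguments mip_feasible {R I m} P _.
Arguments lp_optima {R I m} P _.
Arguments selections {R I m} P lambda _.
Arguments dual_optima {R I m} P _.

(* Main.v *)
Require Import Defs.
From mathcomp Require Import all_boot all_order all_algebra.
From mathcomp Require Import all_classical all_reals all_analysis.
From mathcomp Require Import ring lra.

Set Implicit Arguments.
Unset Strict Implicit.

Import Order.TTheory GRing.Theory Num.Theory.
Import numFieldNormedType.Exports.

Local Open Scope classical_set_scope.
Local Open Scope ring_scope.

(** Write L_i for the Lagrangian of subproblem i at the dual optimum lambda.
    The selected point x_i minimizes L_i over X_i, and the points of conv(X_i)
    with the same Lagrangian value form a face F_i.  Linear programming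
    duality puts the components of any LP optimum in these faces; what the
    argument turns on is strict complementarity: both optima being unique, the
    LP optimum y satisfies y_i = a x_i + (1 - a) w_i for some 0 < a <= 1 and
    w_i in F_i, so that the segment from x_i to y_i can be prolonged beyond y_i
    inside F_i.

    Given this, suppose that x and y differ in more than m components.  The
    vectors H_i (x_i - y_i) of R^m are then linearly dependent over these
    components, say the sum of t_i H_i (x_i - y_i) vanishes.  Moving each y_i
    by a small multiple of t_i (x_i - y_i), whatever the sign of t_i, stays in
    the face F_i by the prolongation and leaves the coupling vector unchanged.
    The result is a second LP optimum, which contradicts uniqueness.

    Strict complementarity comes from the uniqueness of lambda.  A mixed-integer
    polyhedron that is compact has a finite subset meeting the minimizers of
    every linear function [midpoint_free_finite, midpoint_free_minimizer], so
    the dual function is piecewise linear around lambda.  Hence a nonzero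
    direction u that is feasible at lambda, and along which no joint minimizer v
    of the Lagrangians has u . (H v - b) < 0, would yield another dual optimum
    [dual_ascent].  As there is none, Farkas' lemma writes b - H x as a
    nonnegative combination of the vectors H v - b and of the coordinate vectors
    e_j with lambda_j = 0.  Rearranged, this is a weighted average y of x and
    the v's, with positive weight on x, which satisfies the coupling constraints
    and complementary slackness, hence is an LP optimum
    [strict_complementarity, face_optimal]. *)

(** * Dot products *)

Section DotProduct.
Variables (R : realType) (n : nat).
Implicit Types (u v w : 'cV[R]_n) (a : R).

Lemma dotvE u v : dotv u v = \sum_k u k 0 * v k 0.
Proof. by rewrite /dotv mxE; apply: eq_bigr => k _; rewrite mxE. Qed.

Lemma dotvC u v : dotv u v = dotv v u.
Proof. by rewrite !dotvE; apply: eq_bigr => k _; rewrite mulrC. Qed.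

Lemma dotvDr u v w : dotv u (v + w) = dotv u v + dotv u w.
Proof. by rewrite /dotv mulmxDr mxE. Qed.

Lemma dotvZr a u v : dotv u (a *: v) = a * dotv u v.
Proof. by rewrite /dotv -scalemxAr mxE. Qed.

Lemma dotvNr u v : dotv u (- v) = - dotv u v.
Proof. by rewrite -scaleN1r dotvZr mulN1r. Qed.

Lemma dotvBr u v w : dotv u (v - w) = dotv u v - dotv u w.
Proof. by rewrite dotvDr dotvNr. Qed.

Lemma dotvDl u v w : dotv (v + w) u = dotv v u + dotv w u.
Proof. by rewrite !(dotvC _ u) dotvDr. Qed.

Lemma dotvZl a u v : dotv (a *: v) u = a * dotv v u.
Proof. by rewrite !(dotvC _ u) dotvZr. Qed.

Lemma dotvBl u v w : dotv (v - w) u = dotv v u - dotv w u.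
Proof. by rewrite !(dotvC _ u) dotvBr. Qed.

Lemma dotv0r u : dotv u 0 = 0.
Proof. by rewrite -(scale0r u) dotvZr mul0r. Qed.

Lemma dotv_sumr (T : Type) (r : seq T) u (F : T -> 'cV[R]_n) :
  dotv u (\sum_(k <- r) F k) = \sum_(k <- r) dotv u (F k).
Proof.
by elim: r => [|k r IH]; rewrite ?big_nil ?dotv0r// !big_cons dotvDr IH.
Qed.

Lemma dotv_ge0 u : 0 <= dotv u u.
Proof. by rewrite dotvE sumr_ge0// => k _; rewrite -expr2 sqr_ge0. Qed.

Lemma dotv_eq0 u : dotv u u <= 0 -> u = 0.
Proof.
move=> uu; have /eqP : dotv u u = 0 by apply/eqP; rewrite eq_le uu dotv_ge0.
rewrite dotvE psumr_eq0; last by move=> k _; rewrite -expr2 sqr_ge0.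
move=> /allP u0; apply/colP => k; rewrite mxE; apply/eqP.
by have := u0 k (mem_index_enum _); rewrite mulf_eq0 orbb.
Qed.

Lemma dotv_trmx (p : nat) (A : 'M[R]_(n, p)) u (x : 'cV[R]_p) :
  dotv u (A *m x) = dotv (A^T *m u) x.
Proof. by rewrite /dotv trmx_mul trmxK mulmxA. Qed.

Lemma dotv_delta u k : dotv u (delta_mx k 0) = u k 0.
Proof.
rewrite dotvE (bigD1 k)//= big1 => [|l lk]; rewrite mxE.
  by rewrite !eqxx mulr1 addr0.
by rewrite (negbTE lk) mulr0.
Qed.

Lemma dotv_continuous u : continuous (dotv u).
Proof.
have -> : dotv u = fun v => \sum_k u k 0 * v k 0.
  by apply/funext => v; exact: dotvE.
apply: continuous_big => [|k _ v]; first exact: add_continuous.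
exact: (continuousM (@cst_continuous _ _ _ v) (@coord_continuous R n 1 k 0 v)).
Qed.

Lemma sqnorm_continuous : continuous (fun v : 'cV[R]_n => dotv v v).
Proof.
have -> : (fun v => dotv v v) = fun v : 'cV[R]_n => \sum_k v k 0 * v k 0.
  by apply/funext => v; exact: dotvE.
apply: continuous_big => [|k _ v]; first exact: add_continuous.
by apply: continuousM; exact: (@coord_continuous R n 1 k 0 v).
Qed.

End DotProduct.

(** * Farkas' lemma *)

(** Bartl's algebraic proof, by induction on the number of generators.  If a
    vector u is nonnegative on all generators but a, and negative on y, it must
    be negative on a; projecting everything along a onto the hyperplane
    orthogonal to u then preserves the duality hypothesis and removes a. *)
Lemma farkas (R : realType) (n : nat) (T : eqType) (r : seq T)
    (g : T -> 'cV[R]_n) (y : 'cV[R]_n) :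
  uniq r ->
  (forall u, (forall k, k \in r -> 0 <= dotv u (g k)) -> 0 <= dotv u y) ->
  exists2 p : T -> R,
    forall k, 0 <= p k & y = \sum_(k <- r) p k *: g k.
Proof.
elim: r g y => [|a r IH] g y.
  move=> _ ydual; exists (fun=> 0) => //; rewrite big_nil; apply: dotv_eq0.
  by rewrite -oppr_ge0 -dotvNr dotvC ydual.
rewrite cons_uniq => /andP[ar ur] ydual.
(* The multiplier t of a is kept apart from those of r, and since a is not in r
   they glue into one function. *)
suff [t [p [t0 p0 ->]]] : exists t p, [/\ 0 <= t, (forall k : T, 0 <= p k)
    & y = t *: g a + \sum_(k <- r) p k *: g k].
  exists (fun k => if k == a then t else p k) => [k|]; first by case: ifP.
  rewrite big_cons eqxx; congr (_ + _); apply: eq_big_seq => k kr.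
  by rewrite ifN//; apply: contraNneq ar => <-.
have [rdual|] := pselect (forall u,
    (forall k, k \in r -> 0 <= dotv u (g k)) -> 0 <= dotv u y).
  have [p p0 ->] := IH g y ur rdual.
  by exists 0, p; split=> //; rewrite scale0r add0r.
move=> /existsNP[u /not_implyP[ur0 /negP]]; rewrite -ltNge => uy.
have ua : dotv u (g a) < 0.
  rewrite ltNge; apply: contraTN uy => ua; rewrite -leNgt; apply: ydual => k.
  by rewrite inE => /predU1P[->|/ur0].
(* h is the projection along g a onto the orthogonal of u, and the w below is
   its transpose applied to v. *)
pose h (x : 'cV[R]_n) := x - (dotv u x / dotv u (g a)) *: g a.
have [|p p0 hy] := IH (h \o g) (h y) ur.
  move=> v hv; pose w := v - (dotv v (g a) / dotv u (g a)) *: u.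
  have wh x : dotv v (h x) = dotv w x.
    by rewrite dotvBr dotvZr dotvBl dotvZl; ring.
  rewrite wh; apply: ydual => k; rewrite inE => /predU1P[->|kr].
    by rewrite dotvBl dotvZl divfK ?subrr// lt_eqF.
  by rewrite -wh hv.
exists ((dotv u y - \sum_(k <- r) p k * dotv u (g k)) / dotv u (g a)), p.
split => //.
  rewrite -mulrNN mulr_ge0//; last by rewrite -invrN invr_ge0 oppr_ge0 ltW.
  rewrite oppr_ge0 subr_le0 (le_trans (ltW uy))// big_seq sumr_ge0// => k kr.
  by rewrite mulr_ge0// ur0.
rewrite mulrBl scalerBl; set t := (dotv u y / _) *: g a.
rewrite -[LHS](subrK t) -[y - t]/(h y) hy (eq_bigr (fun k =>
  p k *: g k - (p k * dotv u (g k) / dotv u (g a)) *: g a)); last first.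
  by move=> k _; rewrite /= /h scalerBr scalerA mulrA.
by rewrite sumrB -scaler_suml -mulr_suml addrC addrCA addrC.
Qed.

(** * Convex sets *)

Section Convexity.
Variables (R : realType) (n : nat).
Implicit Types (C S : set 'cV[R]_n) (x y : 'cV[R]_n).

Lemma convex_setP C : convex_set C <->
  forall x y t, C x -> C y -> 0 <= t <= 1 -> C (t *: x + (1 - t) *: y).
Proof.
split=> [cC x y t Cx Cy /andP[t0 t1]|cC x y t /set_mem Cx /set_mem Cy].
  exact: set_mem (cC x y (Itv01 t0 t1) (mem_set Cx) (mem_set Cy)).
by apply/mem_set/cC => //; rewrite ge0 le1.
Qed.

(** Weights are left unnormalized so that the degenerate case of a zero total
    weight, where w is arbitrary in C, is included. *)
Lemma convex_sum C (T : Type) (r : seq T) (p : T -> R) (g : T -> 'cV[R]_n) :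
  convex_set C -> C !=set0 -> (forall k, 0 <= p k) -> (forall k, C (g k)) ->
  exists2 w, C w & \sum_(k <- r) p k *: g k = (\sum_(k <- r) p k) *: w.
Proof.
move=> /convex_setP cC [w0 Cw0] p0 Cg; elim: r => [|a r [w Cw IH]].
  by exists w0; rewrite // !big_nil scale0r.
rewrite !big_cons {}IH; set s := \sum_(k <- r) p k.
have s0 : 0 <= s by rewrite sumr_ge0.
have [as0|as0] := eqVneq (p a + s) 0.
  exists w => //; have /eqP := as0; rewrite paddr_eq0// => /andP[/eqP-> /eqP->].
  by rewrite addr0 !scale0r addr0.
have as_gt0 : 0 < p a + s by rewrite lt_neqAle eq_sym as0 addr_ge0.
exists ((p a / (p a + s)) *: g a + (1 - p a / (p a + s)) *: w).
  apply: cC => //; rewrite divr_ge0 ?addr_ge0//= ler_pdivrMr// mul1r.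
  by rewrite lerDl.
by rewrite scalerDr !scalerA; congr (_ *: _ + _ *: _); field.
Qed.

Lemma convhull_convex S : convex_set (convhull S).
Proof.
apply/convex_setP => x y t Sx Sy t01 C [/[dup] cC /convex_setP + SC].
by apply => //; [apply: Sx | apply: Sy].
Qed.

Lemma sub_convhull S : S `<=` convhull S.
Proof. exact: sub_gen_smallest. Qed.

Lemma convhull_dotv_ge S u a :
  (forall x, S x -> a <= dotv u x) -> forall x, convhull S x -> a <= dotv u x.
Proof.
move=> Sa x /(_ [set x | a <= dotv u x]); apply; split => //.
apply/convex_setP => y z t /= ay az /andP[t0 t1].
rewrite dotvDr !dotvZr -[leLHS](subrK (t * a)) -{1}[a]mul1r -mulrBl addrC.
by rewrite lerD// ler_wpM2l// subr_ge0.
Qed.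

(** With y = a x + (1 - a) w, the point y + t (x - y) has weight
    a + t (1 - a) on x, which lies in [0, 1] as long as |t| <= a.  Negative t
    are the ones that matter: they prolong the segment from x to y beyond y. *)
Lemma convex_extend C x w a t : convex_set C -> C x -> C w -> 0 < a <= 1 ->
  `|t| <= a -> C (a *: x + (1 - a) *: w + t *: (x - (a *: x + (1 - a) *: w))).
Proof.
move=> /convex_setP cC Cx Cw /andP[a0 a1]; rewrite ler_norml => /andP[ta tb].
have -> : a *: x + (1 - a) *: w + t *: (x - (a *: x + (1 - a) *: w)) =
    (a + t * (1 - a)) *: x + (1 - (a + t * (1 - a))) *: w.
  by apply/colP => k; rewrite !mxE; ring.
by apply: cC => //; apply/andP; split; nra.
Qed.

End Convexity.

(** * Finitely many points minimize all linear functions *)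

(** The single place where finiteness becomes a positive step length: a finite
    system of inequalities that are strict at the start of a move survives a
    small enough step. *)
Lemma small_step (R : realType) (s : seq (R * R)) :
  exists2 e : R, 0 < e & forall q, q \in s -> 0 < q.1 -> 0 <= q.1 + e * q.2.
Proof.
suff [e e0 es] : exists2 e : R, 0 < e & forall e', 0 < e' <= e ->
    forall q, q \in s -> 0 < q.1 -> 0 <= q.1 + e' * q.2.
  by exists e => //; apply: es; rewrite e0 lexx.
elim: s => [|[a b] s [e e0 IH]]; first by exists 1.
have [a0|a0] := ltP 0 a; last first.
  exists e => // e' e'e q; rewrite inE => /predU1P[-> /=|qs]; last exact: IH.
  by rewrite ltNge a0.
have b1 : 0 < `|b| + 1 by rewrite ltr_wpDl.
exists (Num.min e (a / (`|b| + 1))) => [|e'].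
  by rewrite lt_min e0 divr_gt0.
rewrite le_min => /and3P[e'0 e'e e'a] q.
rewrite inE => /predU1P[-> _ /=|qs]; last by apply: IH; rewrite ?e'0.
move: e'a; rewrite ler_pdivlMr// => e'a.
have := ler_norm (- b); rewrite normrN; nra.
Qed.

Section FiniteMinimizers.
Variable R : realType.

(** This plays the role of the extreme points, but refers to X itself and not to
    its convex hull. *)
Definition midpoint_free n (X : set 'cV[R]_n) : set 'cV[R]_n :=
  [set x | X x /\ forall e, X (x + e) -> X (x - e) -> e = 0].

(** Among the minimizers of the linear function, take one of largest Euclidean
    norm: if it were the midpoint of two distinct points of X, both would be
    minimizers, and by strict convexity of the squared norm one of them would be
    longer. *)
Lemma midpoint_free_minimizer n (X : set 'cV[R]_n) (c : 'cV[R]_n) :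
  compact X -> X !=set0 ->
  exists2 v, midpoint_free X v & forall y, X y -> dotv c v <= dotv c y.
Proof.
move=> cX X0.
have [v /set_mem Xv vmin] := compact_EVT_min X0 cX
  (continuous_subspaceT (@dotv_continuous _ _ c)).
pose Y := X `&` [set x | dotv c x = dotv c v].
have cY : compact Y.
  apply: compact_closedI => //; apply: (@preimage_closed _ _ (dotv c)
    [set t | t = dotv c v]); last exact: closed_eq.
  by move=> x _; exact: dotv_continuous.
have [|x /set_mem[Xx xv] xmax] := compact_EVT_max _ cY
  (continuous_subspaceT (@sqnorm_continuous _ _)).
  by exists v.
exists x => [|y Xy]; last by rewrite xv; apply: vmin; exact: mem_set.
split=> // e Xp Xm.
have ce0 : dotv c e = 0.
  have := vmin _ (mem_set Xp); have := vmin _ (mem_set Xm).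
  rewrite dotvBr dotvDr xv; lra.
have Yp : Y (x + e) by split; rewrite //= dotvDr ce0 addr0.
have Ym : Y (x - e) by split; rewrite //= dotvBr ce0 subr0.
apply: dotv_eq0; have := xmax _ (mem_set Yp); have := xmax _ (mem_set Ym).
rewrite !(dotvBr, dotvBl) !(dotvDr, dotvDl) (dotvC e x); lra.
Qed.

Section MixedInteger.
Variables (r z p : nat) (A : 'M[R]_(p, r + z)) (d : 'cV[R]_p).

Definition mixed_polyhedron : set 'cV[R]_(r + z) :=
  [set x : 'cV[R]_(r + z) |
    (forall k : 'I_z, x (rshift r k) 0 \is a Num.int) /\ vle (A *m x) d].
Local Notation X := mixed_polyhedron.

(** If y has the integer part of x and satisfies with equality all constraints
    that x does, then x + e (y - x) and x - e (y - x) both stay in the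
    polyhedron for small e: integer coordinates do not move, constraints that
    are tight at x stay tight and the others have room. *)
Lemma midpoint_free_inj (x y : 'cV[R]_(r + z)) : midpoint_free X x -> X y ->
  (forall k : 'I_z, x (rshift r k) 0 = y (rshift r k) 0) ->
  (forall j, (A *m x) j 0 = d j 0 -> (A *m y) j 0 = d j 0) -> y = x.
Proof.
move=> [[xint xd] xfree] [yint yd] xyint xyact.
pose w := A *m (y - x).
have [e e0 es] := small_step
  ([seq (d j 0 - (A *m x) j 0, w j 0) | j <- enum 'I_p] ++
   [seq (d j 0 - (A *m x) j 0, - w j 0) | j <- enum 'I_p]).
have Xt t :
    (forall j, (A *m x) j 0 < d j 0 -> t * w j 0 <= d j 0 - (A *m x) j 0) ->
    X (x + t *: (y - x)).
  move=> tw; split=> [k|j].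
    by rewrite !mxE xyint subrr mulr0 addr0 -xyint.
  have E : (A *m (x + t *: (y - x))) j 0 = (A *m x) j 0 + t * w j 0.
    by rewrite mulmxDr -scalemxAr !mxE.
  rewrite E; have := xd j; rewrite le_eqVlt => /predU1P[act|/tw]; last lra.
  suff -> : w j 0 = 0 by rewrite mulr0 addr0 act.
  by rewrite /w mulmxBr mxE xyact// mxE act subrr.
have ee0 : e *: (y - x) = 0.
  apply: xfree.
    apply: Xt => j jd; have := es (d j 0 - (A *m x) j 0, - w j 0).
    rewrite /= subr_gt0 jd mem_cat map_f ?orbT ?mem_enum// => /(_ isT isT); lra.
  rewrite -scaleNr; apply: Xt => j jd; have := es (d j 0 - (A *m x) j 0, w j 0).
  rewrite /= subr_gt0 jd mem_cat map_f ?mem_enum// => /(_ isT isT); lra.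
apply/eqP; rewrite -subr_eq0; apply/eqP.
by move/eqP: ee0; rewrite scaler_eq0 gt_eqF//= => /eqP.
Qed.

(** A midpoint-free point is determined by its set of tight constraints together
    with its integer part, and boundedness leaves finitely many integer
    parts. *)
Lemma midpoint_free_finite : compact X -> finite_set (midpoint_free X).
Proof.
move=> cX.
have [N XN] : exists N : nat, forall x k, X x -> `|x k 0| <= N%:R.
  have [M [_ /(_ (M + 1))]] := compact_bounded cX.
  rewrite ltrDl ltr01 => /(_ isT) XM; exists (Num.truncn (M + 1)).+1 => x k Xx.
  apply: ltW; apply: (le_lt_trans _ (truncnS_gt _)); apply: le_trans (XM x Xx).
  rewrite [leRHS]/Num.norm/= mx_normrE.
  exact: (le_bigmax _ (fun i : 'I__ * 'I_1 => `|x i.1 i.2|) (k, 0)).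
(* Integer coordinates lie in [-N, N]; they are shifted by N to be encoded as
   ordinals. *)
pose sig (x : 'cV[R]_(r + z)) : {set 'I_p} * {ffun 'I_z -> 'I_(N + N).+1} :=
  ([set j | (A *m x) j 0 == d j 0]%SET,
   [ffun k => inord (Num.truncn (x (rshift r k) 0 + N%:R))]).
have sigK x k : X x ->
    x (rshift r k) 0 = ((sig x).2 k)%:R - N%:R.
  move=> Xx; rewrite ffunE; set a := x _ _.
  have := XN x (rshift r k) Xx; rewrite -/a ler_norml => /andP[Na aN].
  have an : a + N%:R \is a Num.nat.
    by rewrite natrEint rpredD// ?natr_int ?(Xx.1 k)//= -lerBlDr sub0r.
  rewrite inordK; first by rewrite truncnK// addrK.
  by rewrite ltnS -(ler_nat R) truncnK// natrD lerD2r.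
rewrite -(eq_finite_set (@inj_card_eq _ _ _ sig _)); first exact: finite_finset.
move=> x y /set_mem xX /set_mem yX sxy; apply: midpoint_free_inj => //.
- by case: xX.
- by move=> k; rewrite !sigK ?sxy//; [case: xX|case: yX].
- move=> j /eqP; have := congr1 (fun s : {set 'I_p} * _ => j \in s.1) sxy.
  by rewrite !inE => <- /eqP.
Qed.

End MixedInteger.

End FiniteMinimizers.

(** * Linear dependence *)

Lemma linear_dependence (F : fieldType) (I : finType) (m : nat)
    (D : {set I}) (h : I -> 'cV[F]_m) : (m < #|D|)%N ->
  exists t : I -> F, [/\ exists2 i, i \in D & t i != 0,
    forall i, i \notin D -> t i = 0 & \sum_i t i *: h i = 0].
Proof.
move=> mD; pose M := \matrix_(k < #|D|, j < m) h (enum_val k) j 0.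
have /rowV0Pn[u /sub_kermxP uM u0] : kermx M != 0.
  rewrite -mxrank_eq0 mxrank_ker subn_eq0 -ltnNge.
  by rewrite (leq_ltn_trans (rank_leq_col _)).
pose t i := \sum_(k < #|D| | enum_val k == i) u 0 k.
have tE k : t (enum_val k) = u 0 k.
  by rewrite /t (big_pred1 k)// => l; rewrite (inj_eq enum_val_inj).
exists t; split => [|i iD|].
- have /rV0Pn[k uk] := u0.
  by exists (enum_val k); rewrite ?enum_valP// tE.
- by rewrite /t big_pred0// => k; apply: contraNF iD => /eqP <-; exact: enum_valP.
apply/colP => j; rewrite summxE mxE.
transitivity ((u *m M) 0 j); last by rewrite uM mxE.
rewrite mxE (partition_big (fun k : 'I_#|D| => enum_val k) xpredT)//=.
apply: eq_bigr => i _; rewrite mxE /t mulr_suml.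
by apply: eq_bigr => k /eqP <-; rewrite mxE.
Qed.

(** * Duality and strict complementarity *)

Section Duality.
Variables (R : realType) (I : finType) (m : nat) (P : mip R I m).
Implicit Types (l u : 'cV[R]_m) (x y : jointvec P).

Definition coupled x : 'cV[R]_m := \sum_i coupl P i *m x i.

Lemma coupled_lin a b x y :
  coupled (fun i => a *: x i + b *: y i) = a *: coupled x + b *: coupled y.
Proof.
rewrite /coupled !scaler_sumr -big_split/=; apply: eq_bigr => i _.
by rewrite mulmxDr -!scalemxAr.
Qed.

Lemma coupled_sum (T : Type) (r : seq T) (p : T -> R) (v : T -> jointvec P) :
  coupled (fun i => \sum_(t <- r) p t *: v t i) =
  \sum_(t <- r) p t *: coupled (v t).
Proof.
rewrite /coupled; under eq_bigr do rewrite mulmx_sumr.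
rewrite exchange_big; apply: eq_bigr => t _; rewrite scaler_sumr.
by apply: eq_bigr => i _; rewrite -scalemxAr.
Qed.

Lemma lagrangianE l i (x : 'cV[R]_(rdim P i + zdim P i)) :
  lagrangian P l i x = dotv (objv P i + (coupl P i)^T *m l) x.
Proof. by rewrite dotvDl -dotv_trmx. Qed.

Lemma lagrangian_step l u e i (x : 'cV[R]_(rdim P i + zdim P i)) :
  lagrangian P (l + e *: u) i x =
  lagrangian P l i x + e * dotv u (coupl P i *m x).
Proof. by rewrite /lagrangian dotvDl dotvZl addrA. Qed.

Lemma sum_lagrangian l x :
  \sum_i lagrangian P l i (x i) = objective x + dotv l (coupled x).
Proof. by rewrite /lagrangian big_split -dotv_sumr. Qed.

Lemma finite_minimizers i : compact (subX P i) -> subX P i !=set0 ->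
  exists s : seq 'cV[R]_(rdim P i + zdim P i), forall l,
    exists2 v, v \in s & argmin (subX P i) (lagrangian P l i) v.
Proof.
move=> cX X0; have /finite_seqP[s Es] := midpoint_free_finite cX.
exists s => l.
have [v vfree vmin] :=
  midpoint_free_minimizer (objv P i + (coupl P i)^T *m l) cX X0.
exists v; first by have : [set` s] v by rewrite -Es.
by split=> [|y Xy]; [case: vfree | rewrite !lagrangianE vmin].
Qed.

(** Piecewise linearity of the dual function at l.  For a small step along u, a
    minimizer of the new Lagrangian found in the finite set of candidates either
    minimizes the old one, or is still worse than x_i.  Thus some joint
    minimizer v of the old Lagrangian bounds the new dual value from below by
    dual_fun l + e u . (H v - b). *)
Lemma dual_ascent l x :
  (forall i, compact (subX P i)) -> (forall i, subX P i !=set0) -> vle 0 l ->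
  (forall i, argmin (subX P i) (lagrangian P l i) (x i)) ->
  exists (T : finType) (v : T -> jointvec P),
    (forall t i, argmin (subX P i) (lagrangian P l i) (v t i)) /\
    forall u, (forall j, l j 0 = 0 -> 0 <= u j 0) ->
      (forall t, 0 <= dotv u (coupled (v t) - rhs P)) ->
      exists2 e, 0 < e & vle 0 (l + e *: u) /\
        dual_fun P l <= dual_fun P (l + e *: u).
Proof.
move=> cX X0 l0 xmin.
have [s smin] := fin_all_exists (fun i => finite_minimizers (cX i) (X0 i)).
pose W i := [seq v <- s i | `[< argmin (subX P i) (lagrangian P l i) v >]].
pose N := \max_i size (W i).
(* Any index past the end of W i selects x i, by default; N is such an index. *)
pose v (t : {ffun I -> 'I_N.+1}) i := nth (x i) (W i) (t i).
have vmin t i : argmin (subX P i) (lagrangian P l i) (v t i).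
  rewrite /v; have [tW|Wt] := ltnP (t i) (size (W i)).
    2: by rewrite nth_default.
  by have := mem_nth (x i) tW; rewrite mem_filter => /andP[/asboolP].
exists {ffun I -> 'I_N.+1}, v; split=> // u uact uv.
have [e e0 es] := small_step ([seq (l j 0, u j 0) | j <- enum 'I_m] ++
  flatten [seq [seq (lagrangian P l i w - lagrangian P l i (x i),
    dotv u (coupl P i *m w) - dotv u (coupl P i *m x i)) | w <- s i]
    | i <- enum I]).
exists e => //; split=> [j|].
  rewrite !mxE; have := l0 j; rewrite mxE le_eqVlt => /predU1P[lj|lj].
    by rewrite -lj add0r mulr_ge0 ?uact// ltW.
  by apply: (es (l j 0, u j 0)) => //; rewrite mem_cat map_f ?mem_enum.
have /fin_all_exists[t tmin] i : exists k : 'I_N.+1,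
    lagrangian P l i (x i) + e * dotv u (coupl P i *m nth (x i) (W i) k) <=
    minval (subX P i) (lagrangian P (l + e *: u) i).
  have [w ws wmin] := smin i (l + e *: u).
  rewrite (minvalE wmin) lagrangian_step.
  have [wW|wW] := boolP (w \in W i).
    have kN : (index w (W i) < N.+1)%N.
      by rewrite ltnS (leq_trans (index_size _ _))// /N (leq_bigmax i).
    exists (Ordinal kN); rewrite /= nth_index// lerD2r.
    by apply: (xmin i).2; case: wmin.
  exists ord_max; rewrite nth_default; last exact: leq_bigmax.
  have xw : lagrangian P l i (x i) < lagrangian P l i w.
    rewrite ltNge; apply: contra wW => wx; rewrite mem_filter ws andbT.
    apply/asboolP; split; first by case: wmin.
    by move=> y Xy; apply: le_trans wx _; apply: (xmin i).2.
  have := es (lagrangian P l i w - lagrangian P l i (x i),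
    dotv u (coupl P i *m w) - dotv u (coupl P i *m x i)).
  rewrite /= subr_gt0 xw mem_cat orbC => /(_ _ isT) esw.
  have : 0 <= lagrangian P l i w - lagrangian P l i (x i) +
      e * (dotv u (coupl P i *m w) - dotv u (coupl P i *m x i)).
    apply: esw; apply/orP; left; apply/flatten_mapP; exists i.
      by rewrite mem_enum.
    by apply/mapP; exists w.
  lra.
rewrite /dual_fun.
have -> : \sum_i minval (subX P i) (lagrangian P l i) =
    \sum_i lagrangian P l i (x i).
  by apply: eq_bigr => i _; exact: minvalE.
have := uv [ffun i => t i]; rewrite dotvBr dotv_sumr.
rewrite (eq_bigr (fun i => dotv u (coupl P i *m nth (x i) (W i) (t i)))).
  2: by move=> i _; rewrite /v ffunE.
move=> ut.
have : \sum_i (lagrangian P l i (x i) +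
    e * dotv u (coupl P i *m nth (x i) (W i) (t i))) <=
  \sum_i minval (subX P i) (lagrangian P (l + e *: u) i).
  by apply: ler_sum => i _; exact: tmin.
rewrite big_split/= -mulr_sumr dotvDl dotvZl.
move: ut; set S := \sum_i dotv _ _; nra.
Qed.

(** For x i a minimizer of the Lagrangian, this is the optimal face of the
    convex hull. *)
Definition face l x i : set 'cV[R]_(rdim P i + zdim P i) :=
  convhull (subX P i) `&` [set z | lagrangian P l i z = lagrangian P l i (x i)].

Arguments face : clear implicits.

Lemma face_convex l x i : convex_set (face l x i).
Proof.
apply/convex_setP => y z t [Cy Ly] [Cz Lz] t01; split.
  by have /convex_setP := @convhull_convex _ _ (subX P i); apply.
move: Ly Lz; rewrite /= !lagrangianE dotvDr !dotvZr => -> ->.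
by rewrite -mulrDl addrC subrK mul1r.
Qed.

Lemma argmin_face l x i v : argmin (subX P i) (lagrangian P l i) (x i) ->
  argmin (subX P i) (lagrangian P l i) v -> face l x i v.
Proof.
move=> [Xx xmin] [Xv vmin]; split; first exact: sub_convhull.
by apply/eqP; rewrite /= eq_le vmin//= xmin.
Qed.

(** Weak duality: on the optimal faces and under complementary slackness the
    objective equals the dual value, which bounds it from below on all feasible
    points. *)
Lemma face_optimal l x y : vle 0 l ->
  (forall i, argmin (subX P i) (lagrangian P l i) (x i)) ->
  (forall i, face l x i (y i)) -> coupling y ->
  dotv l (coupled y - rhs P) = 0 -> lp_optima P y.
Proof.
move=> l0 xmin yface yb compl; split; first by split=> // i; case: (yface i).
move=> z [zb Cz].
have : \sum_i lagrangian P l i (y i) <= \sum_i lagrangian P l i (z i).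
  apply: ler_sum => i _; rewrite (yface i).2 [leRHS]lagrangianE.
  by apply: convhull_dotv_ge (Cz i) => v Xv; rewrite -lagrangianE (xmin i).2.
have : dotv l (coupled z - rhs P) <= 0.
  rewrite dotvE -oppr_ge0 -sumrN sumr_ge0// => j _; rewrite -mulrN mulr_ge0//.
    by have := l0 j; rewrite mxE.
  by have := zb j; rewrite mxE [X in _ + X]mxE oppr_ge0 subr_le0.
move: compl; rewrite !sum_lagrangian !dotvBr; lra.
Qed.

(** Farkas' lemma is applied to the vectors coupled (v t) - rhs, the coordinate
    vectors at the zero entries of l, and the target rhs - coupled x; its dual
    hypothesis holds because an ascent direction would produce a second dual
    optimum.  If S is the total weight of the v's, then a = 1 / (1 + S), and w
    is the weighted average of the v's. *)
Lemma strict_complementarity l x :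
  (forall i, compact (subX P i)) -> (forall i, subX P i !=set0) ->
  dual_optima P = [set l] ->
  (forall i, argmin (subX P i) (lagrangian P l i) (x i)) ->
  exists (a : R) (w : jointvec P),
    let y : jointvec P := fun i => a *: x i + (1 - a) *: w i in
    [/\ 0 < a <= 1, forall i, face l x i (w i), coupling y &
        dotv l (coupled y - rhs P) = 0].
Proof.
move=> cX X0 lopt xmin.
have [l0 lmax] : dual_optima P l by rewrite lopt.
have [T [v [vmin vasc]]] := dual_ascent cX X0 l0 xmin.
pose g (k : T + 'I_m) : 'cV[R]_m := match k with
  | inl t => coupled (v t) - rhs P
  | inr j => if l j 0 == 0 then delta_mx j 0 else 0
  end.
have [||p p0 cone] := @farkas R m _ (index_enum (T + 'I_m)%type) g
  (rhs P - coupled x).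
- exact: index_enum_uniq.
- move=> u ug.
  have [||e e0 [le0 lle]] := vasc u.
  + move=> j lj; have := ug (inr j) (mem_index_enum _).
    by rewrite /= lj eqxx dotv_delta.
  + by move=> t; exact: ug (inl t) (mem_index_enum _).
  have : dual_optima P (l + e *: u).
    by split=> // y y0; exact: le_trans (lmax y y0) lle.
  rewrite lopt /= => /eqP; rewrite -subr_eq0 addrAC subrr add0r scaler_eq0.
  by rewrite gt_eqF//= => /eqP ->; rewrite dotvC dotv0r.
pose S := \sum_t p (inl t).
have S0 : 0 <= S by rewrite sumr_ge0.
have /fin_all_exists2[w wface wE] i := convex_sum (index_enum T)
  (@face_convex l x i) (ex_intro _ (x i) (argmin_face (xmin i) (xmin i)))
  (fun t => p0 (inl t)) (fun t => argmin_face (xmin i) (vmin t i)).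
have S1 : 0 < 1 + S by rewrite ltr_wpDr.
exists (1 + S)^-1, w => /=.
set y := fun i => _.
have yE : coupled y - rhs P = - (1 + S)^-1 *: (\sum_j p (inr j) *: g (inr j)).
  have Sw : S *: coupled w = \sum_t p (inl t) *: coupled (v t).
    rewrite -coupled_sum /coupled scaler_sumr; apply: eq_bigr => i _.
    by rewrite wE scalemxAr.
  have -> : coupled y =
      (1 + S)^-1 *: (coupled x + \sum_t p (inl t) *: coupled (v t)).
    rewrite coupled_lin -Sw scalerDr scalerA; congr (_ + _ *: _).
    by field; rewrite gt_eqF.
  move: cone; rewrite big_sumType/= => cone.
  have -> : \sum_t p (inl t) *: coupled (v t) =
      \sum_t p (inl t) *: (coupled (v t) - rhs P) + S *: rhs P.
    rewrite /S scaler_suml -big_split; apply: eq_bigr => t _ /=.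
    by rewrite scalerBr subrK.
  set Q := \sum_j p (inr j) *: _ in cone *.
  set V := \sum_t p (inl t) *: _ in cone *.
  have -> : V = rhs P - coupled x - Q by rewrite cone addrK.
  apply/colP => j; rewrite !mxE; field; rewrite gt_eqF//.
have yj j : (coupled y - rhs P) j 0 =
    - (1 + S)^-1 * (if l j 0 == 0 then p (inr j) else 0).
  rewrite yE mxE summxE (bigD1 j)//= big1 ?addr0 => [|k kj].
    rewrite mxE; case: ifP => _; rewrite mxE ?eqxx ?mulr1 ?mulr0//.
  rewrite mxE; case: ifP => _; rewrite mxE ?mulr0// eq_sym (negbTE kj) mulr0//.
split=> //.
- by rewrite invr_gt0 S1 invf_le1// lerDl.
- move=> j; rewrite -subr_le0; have := yj j; rewrite mxE [X in _ + X]mxE => ->.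
  by rewrite mulNr oppr_le0 mulr_ge0 ?invr_ge0 ?(ltW S1)//; case: ifP.
rewrite dotvE big1// => j _; rewrite yj; case: eqP => [->|_]; first exact: mul0r.
by rewrite !mulr0.
Qed.

End Duality.

Arguments face {R I m P} l x i _.

Unset Implicit Arguments.

Theorem theorem2p5 (R : realType) (I : finType) (m : nat) (P : mip R I m)
  (m_gt0 : (0 < m)%N)
  (m_lt_I : (m < #|I|)%N)
  (X_nonempty : forall i, subX P i !=set0)
  (X_compact : forall i, compact (subX P i))
  (P_feasible : mip_feasible P !=set0)
  (xLP : jointvec P)
  (xLP_unique : lp_optima P = [set xLP])
  (lambda : 'cV[R]_m)
  (lambda_unique : dual_optima P = [set lambda])
  (x : jointvec P)
  (x_sel : selections P lambda x) :
  exists I1 : {set I},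
    (#|I| - m <= #|I1|)%N /\ (forall i, i \in I1 -> x i = xLP i).
Proof.
have xmin i : argmin (subX P i) (lagrangian P lambda i) (x i) := (x_sel i).2.
have [l0 _] : dual_optima P lambda by rewrite lambda_unique.
have xface i := argmin_face (xmin i) (xmin i).
have [a [w [a01 wface yb compl]]] :=
  strict_complementarity X_compact X_nonempty lambda_unique xmin.
pose y : jointvec P := fun i => a *: x i + (1 - a) *: w i.
have yxLP z : (forall i, face lambda x i (z i)) ->
    coupled z = coupled y -> z = xLP.
  move=> zface zy; have : lp_optima P z; last by rewrite xLP_unique.
  by apply: (face_optimal l0 xmin zface); rewrite /coupling -/(coupled z) zy.
have ycE i t (ta : `|t| <= a) : face lambda x i (y i + t *: (x i - y i)).
  exact: convex_extend (@face_convex _ _ _ _ _ _ _) (xface i) (wface i) a01 ta.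
have yE : y = xLP.
  apply: yxLP => // i; have := ycE i 0; rewrite normr0 scale0r addr0; apply.
  by case/andP: a01 => /ltW.
subst xLP.
exists [set i | x i == y i]%SET; split=> [|i]; last by rewrite inE => /eqP.
rewrite leq_subLR addnC -(cardsC [set i | x i == y i]%SET) leq_add2l leqNgt.
apply/negP.
move=> /(linear_dependence (fun i => coupl P i *m (x i - y i))).
move=> [t [[k kD tk] _ tsum]].
(* The step a / M makes every move a / M * t i at most a in absolute value. *)
pose M := 1 + \sum_i `|t i|.
have tM i : `|t i| <= M.
  by rewrite /M (bigD1 i)//= addrCA lerDl addr_ge0// sumr_ge0.
have M0 : 0 < M by rewrite ltr_pwDl// sumr_ge0.
pose z : jointvec P := fun i => y i + (a / M * t i) *: (x i - y i).
have zy : z = y.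
  apply: yxLP => [i|].
    apply: ycE; case/andP: a01 => a0 _.
    rewrite normrM [`|a / M|]ger0_norm ?divr_ge0 ?(ltW a0) ?(ltW M0)//.
    by rewrite mulrAC ler_pdivrMr// ler_pM2l.
  transitivity (coupled y + (a / M) *: coupled (fun i => t i *: (x i - y i))).
    rewrite -[X in X + _]scale1r -coupled_lin; apply: eq_bigr => i _.
    by rewrite scale1r scalerA.
  rewrite [X in _ *: X](_ : _ = 0) ?scaler0 ?addr0// -[RHS]tsum.
  by apply: eq_bigr => i _; rewrite scalemxAr.
have /eqP : z k = y k by rewrite zy.
rewrite -subr_eq0 addrAC subrr add0r scaler_eq0 !mulf_eq0 invr_eq0.
rewrite (negbTE tk) !gt_eqF//=; last by case/andP: a01.
by rewrite subr_eq0; move: kD; rewrite !inE => /negbTE ->.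
Qed.
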